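(* Let $m\in\mathbb{C}$ not be a negative integer, let $m'\ge 0$ be an integer and let $n\ge 1$ be an integer. Then, for $x>0$, $$\int x^m(\ln x)^{m'}\,d^nx=(m')!\,\Gamma(m+1)\frac{x^{n+m}}{\Gamma(n+m+1)}\left[\sum_{k=0}^{m'}(-1)^{m'-k}\frac{(\ln x)^k}{k!}\,\zeta^{\star}_{1+m,n+m}(\{1\}_{m'-k})\right]+C_n(x),$$ where $$\zeta^{\star}_{1+m,n+m}(\{1\}_{m'-k})=\sum_{N_{m'-k}=1+m}^{n+m}\cdots\sum_{N_2=1+m}^{N_3}\sum_{N_1=1+m}^{N_2}\frac{1}{N_{m'-k}}\cdots\frac{1}{N_2}\frac{1}{N_1}$$ and $C_n(x)=\sum_{i=0}^{n-1}c_i\frac{x^i}{i!}$ with arbitrary constants of integration $c_0,\dots,c_{n-1}$.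
   Context: $\int g(x)\,d^nx$ denotes the $n$-fold indefinite integral $\int\cdots\int g(x)\,dx\cdots dx$ ($n$ integral signs), i.e. the family of all functions on $(0,\infty)$ whose $n$-th derivative is $g$; the equality says that this family consists exactly of the functions on the right as the constants $c_i$ vary. $\Gamma$ is the gamma function and $x^m=e^{m\ln x}$. The summation variables $N_j$ in $\zeta^\star$ run over values in $\{1+m,2+m,\dots,n+m\}$, in steps of $1$: writing $N_j=m+r_j$, the sum is $\sum_{1\le r_1\le r_2\le\cdots\le r_p\le n}\prod_{j=1}^{p}\frac{1}{m+r_j}$ with $p=m'-k$. For $p=0$ the value is $\zeta^{\star}_{1+m,n+m}(\{1\}_0)=1$. Convention: $(\ln x)^0=1$. *)

(* Defs.v *)
From Stdlib Require Export Reals Factorial.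
From Coquelicot Require Export Coquelicot.
Open Scope R_scope.

Definition cexp (z : C) : C :=
  (RtoC (exp (Re z)) * (cos (Im z), sin (Im z)))%C.

(* Only meaningful for 0 < x: Stdlib's [ln] is 0 on nonpositive reals. *)
Definition cpower (x : R) (m : C) : C := cexp (m * RtoC (ln x))%C.

(* Both components are total limits; when the sequence converges in C this is
   its limit. *)
Definition C_lim_seq (u : nat -> C) : C :=
  (real (Lim_seq (fun j => Re (u j))), real (Lim_seq (fun j => Im (u j)))).

(* [rising z j] = z (z + 1) ... (z + j), with j + 1 factors. *)
Fixpoint rising (z : C) (j : nat) : C :=
  match j with
  | O => z
  | S i => (rising z i * (z + RtoC (INR (S i))))%C
  end.

(* Euler's definition
     Gamma(z) = lim_j  j! j^z / (z (z + 1) ... (z + j)),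
   valid at every z other than 0, -1, -2, ..., so that no separate analytic
   continuation of the integral over Re z > 0 is needed. *)
Definition CGamma (z : C) : C :=
  C_lim_seq (fun j => (RtoC (INR (fact j)) * cpower (INR j) z / rising z j)%C).

(* [zeta_star_ones m n p] is zeta*_{1+m,n+m}({1}_p): the outermost variable is
   N_p = m + r with 1 <= r <= n, and the inner sum then has upper end m + r. *)
Fixpoint zeta_star_ones (m : C) (n p : nat) : C :=
  match p with
  | O => RtoC 1
  | S q => sum_n_m (fun r => (/ (m + RtoC (INR r)) * zeta_star_ones m r q)%C) 1 n
  end.

(* [F] is n times differentiable on (0, +oo), with n-th derivative [g] there;
   values at nonpositive reals play no role.  Coquelicot's [is_derive_n] only
   covers real-valued functions. *)
Fixpoint is_nth_derive_pos (n : nat) (F g : R -> C) : Prop :=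
  match n with
  | O => forall x : R, 0 < x -> F x = g x
  | S k => exists F' : R -> C,
      (forall x : R, 0 < x ->
         is_derive (K := R_AbsRing) (V := C_R_NormedModule) F x (F' x)) /\
      is_nth_derive_pos k F' g
  end.

(* Main.v *)
(* Let A_n(x) be the closed form without the polynomial. Then A_0 is the
   integrand, and A_(n+1)' = A_n because of the recurrence
     zeta*_(n+1)(q+1) = zeta*_n(q+1) + zeta*_(n+1)(q) / (m+n+1)
   together with Gamma(n+m+2) = (n+m+1) Gamma(n+m+1); two n-fold antiderivatives
   on (0, +oo) differ by a polynomial of degree less than n.
   For Euler's sequence u_j defining Gamma(z), both u_(j+1)/u_j and its inverse
   are 1 + O(1/j^2), so u and 1/u both converge: Gamma(z) exists and is nonzero,
   and the functional equation is read off u_j(z+1) = z u_j(z) j / (z+j+1). *)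

Require Import Defs.
From Stdlib Require Import Reals.
From Coquelicot Require Import Coquelicot.
From Stdlib Require Import Lra Lia.

(** * Derivatives of complex-valued functions of a real variable *)

Local Notation is_derive_RC := (is_derive (K := R_AbsRing) (V := C_R_NormedModule)).

(* [ring] and [field] do not see through Coquelicot's structures on [C]. *)
Local Ltac eq_in_C := match goal with |- ?a = ?b => change (@eq C a b) end.

(** The projections [Re] and [Im] and the pairing map are real-linear, hence their own
    differentials, so the chain rule works in both directions. This reduces complex-valued calculus
    to real calculus. *)
Lemma is_derive_RC_iff (f : R -> C) (x : R) (l : C) :
  is_derive_RC f x l <->
  is_derive (fun t => Re (f t)) x (Re l) /\ is_derive (fun t => Im (f t)) x (Im l).
Proof.
  split.
  - intro H; split.
    + refine (filterdiff_ext_lin _ _ _ (filterdiff_comp' f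
        (fun z : C_R_NormedModule => Re z) x _ (fun z => Re z) H _) _); [|easy].
      exact (filterdiff_linear _ (is_linear_fst (U := R_NormedModule) (V := R_NormedModule))).
    + refine (filterdiff_ext_lin _ _ _ (filterdiff_comp' f
        (fun z : C_R_NormedModule => Im z) x _ (fun z => Im z) H _) _); [|easy].
      exact (filterdiff_linear _ (is_linear_snd (U := R_NormedModule) (V := R_NormedModule))).
  - intros [HR HI].
    apply (is_derive_ext (V := C_R_NormedModule) (fun t => (Re (f t), Im (f t)))).
    { intro t; now rewrite (surjective_pairing (f t)). }
    refine (filterdiff_ext_lin _ _ _ (filterdiff_comp'_2 (U := R_NormedModule)
      (V := R_NormedModule) (W := C_R_NormedModule) (fun t => Re (f t))
      (fun t => Im (f t)) pair x _ _ pair HR HI _) _); [|easy].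
    apply (filterdiff_ext_lin (V := C_R_NormedModule)
       (fun t : R * R => (fst t, snd t)) (fun t => (fst t, snd t))); [|easy].
    apply (filterdiff_linear (V := C_R_NormedModule)).
    apply (is_linear_prod (U := R_NormedModule) (V := R_NormedModule)).
    + exact (is_linear_fst (U := R_NormedModule) (V := R_NormedModule)).
    + exact (is_linear_snd (U := R_NormedModule) (V := R_NormedModule)).
Qed.

Lemma is_derive_RC_eq (f : R -> C) (x : R) (l l' : C) :
  is_derive_RC f x l -> l = l' -> is_derive_RC f x l'.
Proof. now intros H <-. Qed.

Lemma is_derive_RC_ext_pos (f g : R -> C) (x : R) (l : C) :
  0 < x -> (forall t, 0 < t -> f t = g t) -> is_derive_RC f x l -> is_derive_RC g x l.
Proof.
  intros Hx Hfg. apply is_derive_ext_loc.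
  apply (filter_imp (fun t => 0 < t)); [exact Hfg|].
  exact (open_gt 0 x Hx).
Qed.

Lemma is_derive_RC_plus (f g : R -> C) (x : R) (l k : C) :
  is_derive_RC f x l -> is_derive_RC g x k ->
  is_derive_RC (fun t => f t + g t)%C x (l + k)%C.
Proof. exact (is_derive_plus (V := C_R_NormedModule) f g x l k). Qed.

(** [C] enters here as a real normed module, whose structure has no product, so the Leibniz rule is
    assembled from the real one on the components. *)
Lemma is_derive_RC_mult (f g : R -> C) (x : R) (l k : C) :
  is_derive_RC f x l -> is_derive_RC g x k ->
  is_derive_RC (fun t => f t * g t)%C x (l * g x + f x * k)%C.
Proof.
  rewrite !is_derive_RC_iff. intros [Hf Hf'] [Hg Hg'].
  assert (M : forall (p q : R -> R) (dp dq : R), is_derive p x dp -> is_derive q x dq ->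
            is_derive (fun t => p t * q t) x (dp * q x + p x * dq)).
  { intros p q dp dq Hp Hq.
    exact (is_derive_mult (K := R_AbsRing) p q x dp dq Hp Hq Rmult_comm). }
  split.
  - evar_last.
    + exact (is_derive_minus (V := R_NormedModule) _ _ _ _ _ (M _ _ _ _ Hf Hg) (M _ _ _ _ Hf' Hg')).
    + unfold minus, plus, opp, Cplus, Cmult, Re, Im; simpl; ring.
  - evar_last.
    + exact (is_derive_plus (V := R_NormedModule) _ _ _ _ _ (M _ _ _ _ Hf Hg') (M _ _ _ _ Hf' Hg)).
    + unfold plus, Cplus, Cmult, Re, Im; simpl; ring.
Qed.

Lemma is_derive_RC_const (c : C) (x : R) : is_derive_RC (fun _ => c) x (RtoC 0).
Proof. exact (is_derive_const (V := C_R_NormedModule) c x). Qed.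

Lemma is_derive_RC_scal (c : C) (f : R -> C) (x : R) (l : C) :
  is_derive_RC f x l -> is_derive_RC (fun t => c * f t)%C x (c * l)%C.
Proof.
  intro H. eapply is_derive_RC_eq.
  - exact (is_derive_RC_mult _ _ x _ _ (is_derive_RC_const c x) H).
  - cbv beta. ring.
Qed.

Lemma is_derive_RC_RtoC (f : R -> R) (x l : R) :
  is_derive f x l -> is_derive_RC (fun t => RtoC (f t)) x (RtoC l).
Proof.
  intro H. apply is_derive_RC_iff. split; [exact H|].
  exact (is_derive_const (V := R_NormedModule) 0 x).
Qed.

Lemma is_derive_RC_sum_n (f f' : nat -> R -> C) (N : nat) (x : R) :
  (forall k, (k <= N)%nat -> is_derive_RC (f k) x (f' k x)) ->
  is_derive_RC (fun t => sum_n (fun k => f k t) N) x (sum_n (fun k => f' k x) N).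
Proof.
  exact (is_derive_sum_n (V := C_R_NormedModule) (fun k t => f k t) N x (fun k => f' k x)).
Qed.

(** * Complex powers of a positive real *)

Lemma is_derive_cpower (z : C) (x : R) :
  0 < x -> is_derive_RC (fun t => cpower t z) x (z * cpower x z / RtoC x)%C.
Proof.
  intro Hx. destruct z as [a b]. apply is_derive_RC_iff.
  unfold cpower, cexp; split; simpl; auto_derive; try easy;
    (* This is the squared modulus in the denominator of the inverse of [RtoC x]. *)
    replace (x * (x * 1) + 0 * (0 * 1)) with (x * x) by ring;
    change (a * ln x + - (b * 0)) with (a * ln x - b * 0); field; lra.
Qed.

Lemma cexp_plus (w z : C) : cexp (w + z) = (cexp w * cexp z)%C.
Proof.
  destruct w as [a b], z as [c d]. unfold cexp; simpl.
  rewrite exp_plus, cos_plus, sin_plus.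
  apply injective_projections; simpl; ring.
Qed.

Lemma cpower_plus (x : R) (w z : C) : cpower x (w + z) = (cpower x w * cpower x z)%C.
Proof. unfold cpower. rewrite <- cexp_plus. f_equal. ring. Qed.

Lemma cpower_1 (x : R) : 0 < x -> cpower x (RtoC 1) = RtoC x.
Proof.
  intro Hx. unfold cpower, cexp; simpl.
  replace (1 * ln x - 0 * 0) with (ln x) by ring. replace (1 * 0 + 0 * ln x) with 0 by ring.
  rewrite exp_ln, cos_0, sin_0 by easy. apply injective_projections; simpl; ring.
Qed.

Lemma RtoC_neq_0 (x : R) : x <> 0 -> RtoC x <> RtoC 0.
Proof. intros H E. apply H. now injection E. Qed.

(** * Antiderivatives on the positive half-line, up to polynomials *)

Lemma is_derive_RC_zero_const (f : R -> C) :
  (forall x, 0 < x -> is_derive_RC f x (RtoC 0)) ->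
  forall x, 0 < x -> f x = f 1.
Proof.
  intro Hf.
  (* The mean value theorem fails for complex values, so it is applied to each component, on the
     segment between 1 and [x], which stays positive. *)
  assert (Hreal : forall g : R -> R, (forall x, 0 < x -> is_derive g x 0) ->
            forall x, 0 < x -> g x = g 1).
  { intros g Hg x Hx.
    assert (Hpos : forall t, Rmin 1 x <= t -> 0 < t).
    { intros t Ht. eapply Rlt_le_trans; [|exact Ht]. now apply Rmin_pos; [lra|]. }
    destruct (MVT_gen g 1 x (fun _ => 0)) as (c & _ & E).
    - intros t [Ht _]. apply Hg, Hpos. lra.
    - intros t [Ht _]. apply continuity_pt_filterlim, (ex_derive_continuous g).
      exists 0. now apply Hg, Hpos.
    - lra. }
  intros x Hx.
  apply injective_projections.
  - apply (Hreal (fun t => fst (f t))); [|easy]. intros t Ht.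
    exact (proj1 (proj1 (is_derive_RC_iff f t (RtoC 0)) (Hf t Ht))).
  - apply (Hreal (fun t => snd (f t))); [|easy]. intros t Ht.
    exact (proj2 (proj1 (is_derive_RC_iff f t (RtoC 0)) (Hf t Ht))).
Qed.

(** [sum_n] includes its upper index, so [n = 0] needs its own case: a sum up to the truncated
    [n - 1] would keep a constant term and break the induction on [n]. *)
Definition poly_lt (n : nat) (c : nat -> C) (x : R) : C :=
  match n with
  | O => RtoC 0
  | S k => sum_n (fun i => c i * (RtoC x ^ i / RtoC (INR (fact i))))%C k
  end.

Lemma is_derive_monomial (i : nat) (x : R) :
  is_derive_RC (fun t => RtoC t ^ S i / RtoC (INR (fact (S i))))%C x
    (RtoC x ^ i / RtoC (INR (fact i)))%C.
Proof.
  apply (is_derive_ext (V := C_R_NormedModule) (fun t => RtoC (t ^ S i / INR (fact (S i))))).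
  { intro t. rewrite RtoC_div, RtoC_pow. easy. apply INR_fact_neq_0. }
  rewrite <- RtoC_pow, <- RtoC_div by apply INR_fact_neq_0.
  apply is_derive_RC_RtoC. auto_derive; [easy|].
  change (1 * (INR (S i) * x ^ i) * / INR (fact (S i)) = x ^ i / INR (fact i)).
  rewrite fact_simpl, mult_INR. field.
  split; [apply INR_fact_neq_0 | now apply not_0_INR].
Qed.

Lemma poly_lt_S (n : nat) (c : nat -> C) (x : R) :
  poly_lt (S n) c x =
  (c O + match n with O => RtoC 0 | S k =>
    sum_n (fun i => c (S i) * (RtoC x ^ S i / RtoC (INR (fact (S i)))))%C k end)%C.
Proof.
  unfold poly_lt. destruct n as [|k].
  - rewrite sum_O. simpl. field.
  - unfold sum_n at 1. rewrite sum_Sn_m, <- sum_n_m_S by lia.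
    change plus with Cplus. unfold sum_n. f_equal. simpl. field.
Qed.

(** With the basis [x^i / i!], differentiation is just a shift of the coefficients. *)
Lemma is_derive_poly_lt (n : nat) (c : nat -> C) (x : R) :
  is_derive_RC (poly_lt (S n) c) x (poly_lt n (fun i => c (S i)) x).
Proof.
  eapply (is_derive_ext (V := C_R_NormedModule)).
  { intro t. symmetry. apply poly_lt_S. }
  eapply is_derive_RC_eq.
  - apply is_derive_RC_plus; [apply is_derive_RC_const|].
    instantiate (1 := poly_lt n (fun i => c (S i)) x).
    destruct n as [|k]; [apply is_derive_RC_const|].
    apply (is_derive_RC_sum_n (fun i t => c (S i) * (RtoC t ^ S i / RtoC (INR (fact (S i)))))%C
      (fun i t => c (S i) * (RtoC t ^ i / RtoC (INR (fact i))))%C).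
    intros i _. apply is_derive_RC_scal, is_derive_monomial.
  - ring.
Qed.

(** Induction on [n]: the hypothesis, applied to the first derivatives of [F] and [P], gives their
    difference as a polynomial, and one integration adds one constant. *)
Lemma is_nth_derive_pos_iff (n : nat) (P g : R -> C) :
  is_nth_derive_pos n P g ->
  forall F, is_nth_derive_pos n F g <->
    exists c, forall x, 0 < x -> F x = (P x + poly_lt n c x)%C.
Proof.
  revert P. induction n as [|n IH]; intros P HP F.
  - simpl in *. split.
    + intro HF. exists (fun _ => RtoC 0). intros x Hx. rewrite HF, HP by easy. ring.
    + intros [c Hc] x Hx. rewrite Hc, HP by easy. ring.
  - destruct HP as (P' & HPd & HP'). split.
    + intros (F' & HFd & HF').
      apply (IH P' HP') in HF'. destruct HF' as [c Hc].
      (* [c1] integrates the polynomial [c] with zero constant term; [H] is then [F] minus [P] minus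
         this primitive, and its derivative vanishes. The constant [H 1] becomes the new coefficient
         of index 0. *)
      set (c1 := fun i => match i with O => RtoC 0 | S j => c j end).
      set (H := fun x => (F x + (RtoC (-1) * P x + RtoC (-1) * poly_lt (S n) c1 x))%C).
      assert (HH : forall x, 0 < x -> H x = H 1).
      { apply is_derive_RC_zero_const. intros x Hx.
        eapply is_derive_RC_eq.
        - apply is_derive_RC_plus; [now apply HFd|].
          apply is_derive_RC_plus; apply is_derive_RC_scal; [now apply HPd|].
          apply is_derive_poly_lt.
        - simpl. rewrite Hc by easy. change (fun i => c i) with c. ring. }
      exists (fun i => match i with O => H 1 | S j => c j end).
      intros x Hx. rewrite poly_lt_S. cbv beta iota. rewrite <- (HH x Hx).
      unfold H. rewrite poly_lt_S. unfold c1. cbv beta iota. ring.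
    + intros [c Hc].
      exists (fun x => P' x + poly_lt n (fun i => c (S i)) x)%C. split.
      * intros x Hx. apply (is_derive_RC_ext_pos (fun t => P t + poly_lt (S n) c t)%C); [easy| |].
        { intros t Ht. now rewrite Hc. }
        apply is_derive_RC_plus; [now apply HPd | apply is_derive_poly_lt].
      * apply (IH P' HP'). now exists (fun i => c (S i)).
Qed.

(** * Complex sequences with summable relative increments *)

Lemma Rabs_sin_le (x : R) : Rabs (sin x) <= Rabs x.
Proof.
  assert (H : Rabs (sin x - sin 0) <= 1 * Rabs (x - 0)).
  { apply (bounded_variation sin cos). intros t _. split.
    - auto_derive; [easy | ring].
    - apply Rabs_le, COS_bound. }
  rewrite sin_0, !Rminus_0_r in H. lra.
Qed.

(** The trigonometric bounds feed one another: each bounds the derivative in the next mean value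
    inequality. *)
Lemma Rabs_cos_minus_1_le (x : R) : Rabs (cos x - 1) <= x ^ 2.
Proof.
  assert (H : Rabs (cos x - cos 0) <= Rabs x * Rabs (x - 0)).
  { apply (bounded_variation cos (fun t => - sin t)). intros t Ht. split.
    - auto_derive; [easy | ring].
    - rewrite !Rminus_0_r in Ht. rewrite Rabs_Ropp.
      apply (Rle_trans _ _ _ (Rabs_sin_le t) Ht). }
  rewrite cos_0, !Rminus_0_r, <- Rabs_mult, (Rabs_pos_eq (x * x)) in H by nra. simpl. lra.
Qed.

Lemma Rabs_sin_minus_id_le (x : R) : Rabs x <= 1 -> Rabs (sin x - x) <= x ^ 2.
Proof.
  intro Hx.
  assert (H : Rabs ((sin x - x) - (sin 0 - 0)) <= Rabs x * Rabs (x - 0)).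
  { apply (bounded_variation (fun t => sin t - t) (fun t => cos t - 1)). intros t Ht. split.
    - auto_derive; [easy | ring].
    - rewrite !Rminus_0_r in Ht. apply (Rle_trans _ _ _ (Rabs_cos_minus_1_le t)).
      rewrite <- pow2_abs. generalize (Rabs_pos t). nra. }
  rewrite sin_0, !Rminus_0_r, <- Rabs_mult, (Rabs_pos_eq (x * x)) in H by nra. simpl. lra.
Qed.

(** From [exp (- x) >= 1 - x] one gets [exp x <= 1 / (1 - x)], whose excess over [1 + x] is
    [x^2 / (1 - x)]. *)
Lemma Rabs_exp_minus_1_minus_id_le (x : R) : Rabs x <= 1 / 2 -> Rabs (exp x - 1 - x) <= 2 * x ^ 2.
Proof.
  intro Hx. apply Rabs_le_between in Hx.
  pose proof (exp_ineq1_le x). pose proof (exp_ineq1_le (- x)) as Hn.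
  assert (E : exp x * exp (- x) = 1) by (rewrite <- exp_plus, Rplus_opp_r; apply exp_0).
  pose proof (exp_pos x).
  assert (exp x * (1 - x) <= 1) by (rewrite <- E; apply Rmult_le_compat_l; lra).
  rewrite Rabs_pos_eq by lra. assert (exp x <= 2) by nra. nra.
Qed.

Lemma Cmod_le_Rabs_plus (z : C) : Cmod z <= Rabs (Re z) + Rabs (Im z).
Proof.
  destruct z as [a b].
  replace (a, b) with (RtoC a + Ci * RtoC b)%C
    by (apply injective_projections; simpl; ring).
  eapply Rle_trans; [apply Cmod_triangle|].
  rewrite Cmod_mult, Cmod_Ci, !Cmod_R. simpl.
  apply Req_le. f_equal; [f_equal | rewrite Rmult_1_l; f_equal]; ring.
Qed.

Lemma im_le_Cmod (z : C) : Rabs (Im z) <= Cmod z.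
Proof. eapply Rle_trans; [apply Rmax_r | apply Rmax_Cmod]. Qed.

Lemma Cmod_cexp_minus_1_minus_id_le (w : C) :
  Cmod w <= 1 / 2 -> Cmod (cexp w - 1 - w) <= 10 * Cmod w ^ 2.
Proof.
  intro Hw. set (r := Cmod w) in *.
  pose proof (re_le_Cmod w) as Ha. pose proof (im_le_Cmod w) as Hb. fold r in Ha, Hb.
  destruct w as [a b]. unfold cexp. simpl Re in *. simpl Im in *.
  eapply Rle_trans; [apply Cmod_le_Rabs_plus|]. simpl.
  pose proof (Rabs_exp_minus_1_minus_id_le a ltac:(lra)) as He.
  pose proof (Rabs_cos_minus_1_le b) as Hc.
  pose proof (Rabs_sin_minus_id_le b ltac:(lra)) as Hs.
  pose proof (Rabs_sin_le b) as Hs'.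
  assert (Ha2 : a ^ 2 <= r ^ 2) by (rewrite <- pow2_abs; apply pow_incr; split; [apply Rabs_pos|easy]).
  assert (Hb2 : b ^ 2 <= r ^ 2) by (rewrite <- pow2_abs; apply pow_incr; split; [apply Rabs_pos|easy]).
  assert (He2 : Rabs (exp a) <= 2).
  { rewrite Rabs_pos_eq by (left; apply exp_pos). apply Rabs_le_between in He, Ha. nra. }
  assert (He1 : Rabs (exp a - 1) <= 2 * r).
  { replace (exp a - 1) with ((exp a - 1 - a) + a) by ring.
    eapply Rle_trans; [apply Rabs_triang|]. pose proof (Rabs_pos a). nra. }
  (* Both components are split into second-order pieces. Their bounds 2, 2, 2 and 1 times [r ^ 2]
     add up to less than the stated 10. *)
  replace (exp a * cos b - 0 * sin b + - (1) + - a) with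
    ((exp a - 1 - a) + exp a * (cos b - 1)) by ring.
  replace (exp a * sin b + 0 * cos b + - 0 + - b) with
    ((exp a - 1) * sin b + (sin b - b)) by ring.
  pose proof (Rabs_triang (exp a - 1 - a) (exp a * (cos b - 1))) as T1.
  pose proof (Rabs_triang ((exp a - 1) * sin b) (sin b - b)) as T2.
  rewrite Rabs_mult in T1, T2.
  assert (Rabs (exp a) * Rabs (cos b - 1) <= 2 * r ^ 2).
  { apply Rmult_le_compat; try apply Rabs_pos; lra. }
  assert (Rabs (exp a - 1) * Rabs (sin b) <= (2 * r) * r).
  { apply Rmult_le_compat; try apply Rabs_pos; lra. }
  simpl in *. nra.
Qed.

Lemma ln_le_sub_1 (x : R) : 0 < x -> ln x <= x - 1.
Proof. intro Hx. pose proof (exp_ineq1_le (ln x)) as H. rewrite exp_ln in H; lra. Qed.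

(** Both bounds are [ln y <= y - 1], taken at the quotient and at its reciprocal. *)
Lemma ln_succ_div_bounds (j : R) :
  0 < j -> / (j + 1) <= ln ((j + 1) / j) <= / j.
Proof.
  intro Hj. split.
  - pose proof (ln_le_sub_1 (j / (j + 1)) ltac:(apply Rdiv_lt_0_compat; lra)) as H.
    replace ((j + 1) / j) with (/ (j / (j + 1))) by (field; lra).
    rewrite ln_Rinv by (apply Rdiv_lt_0_compat; lra).
    replace (/ (j + 1)) with (- (j / (j + 1) - 1)) by (field; lra). lra.
  - eapply Rle_trans; [apply ln_le_sub_1; apply Rdiv_lt_0_compat; lra|].
    apply Req_le. field; lra.
Qed.

(** * Convergence criteria for complex sequences *)

Definition is_lim_C (u : nat -> C) (l : C) : Prop :=
  is_lim_seq (fun j => Re (u j)) (Re l) /\ is_lim_seq (fun j => Im (u j)) (Im l).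

Lemma C_lim_seq_unique (u : nat -> C) (l : C) : is_lim_C u l -> C_lim_seq u = l.
Proof.
  intros [H1 H2]. unfold C_lim_seq.
  rewrite (is_lim_seq_unique _ _ H1), (is_lim_seq_unique _ _ H2). now destruct l.
Qed.

Lemma is_lim_C_mult (u v : nat -> C) (l k : C) :
  is_lim_C u l -> is_lim_C v k -> is_lim_C (fun j => u j * v j)%C (l * k)%C.
Proof.
  intros [H1 H2] [H3 H4]. split; simpl.
  - apply is_lim_seq_minus'; now apply is_lim_seq_mult'.
  - apply is_lim_seq_plus'; now apply is_lim_seq_mult'.
Qed.

Lemma is_lim_C_const (c : C) : is_lim_C (fun _ => c) c.
Proof. split; apply is_lim_seq_const. Qed.

Lemma is_lim_C_ext_loc (u v : nat -> C) (l : C) (J : nat) :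
  (forall j, (J <= j)%nat -> u j = v j) -> is_lim_C u l -> is_lim_C v l.
Proof.
  intros E [H1 H2]; split.
  - apply (is_lim_seq_ext_loc (fun j => Re (u j))); [exists J; intros; now rewrite E | easy].
  - apply (is_lim_seq_ext_loc (fun j => Im (u j))); [exists J; intros; now rewrite E | easy].
Qed.

Lemma is_lim_C_incr_n (u : nat -> C) (J : nat) (l : C) :
  is_lim_C (fun j => u (j + J)%nat) l -> is_lim_C u l.
Proof.
  intros [H1 H2]. split.
  - now apply (is_lim_seq_incr_n (fun j => Re (u j)) J).
  - now apply (is_lim_seq_incr_n (fun j => Im (u j)) J).
Qed.

Lemma is_lim_C_of_Cmod_le (u : nat -> C) (l : C) (t : nat -> R) (J : nat) :
  is_lim_seq t 0 -> (forall j, (J <= j)%nat -> Cmod (u j - l) <= t j) -> is_lim_C u l.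
Proof.
  intros Ht Hu.
  assert (Hp : forall a : R, is_lim_seq (fun j => a + t j) a).
  { intro a. replace (Finite a) with (Finite (a + 0)) by now rewrite Rplus_0_r.
    now apply is_lim_seq_plus'; [apply is_lim_seq_const|]. }
  assert (Hm : forall a : R, is_lim_seq (fun j => a - t j) a).
  { intro a. replace (Finite a) with (Finite (a - 0)) by now rewrite Rminus_0_r.
    now apply is_lim_seq_minus'; [apply is_lim_seq_const|]. }
  split.
  - refine (is_lim_seq_le_le_loc _ _ _ _ _ (Hm _) (Hp _)). exists J. intros j Hj.
    pose proof (Rle_trans _ _ _ (re_le_Cmod _) (Hu j Hj)) as H.
    apply Rabs_le_between in H. simpl in H. unfold Re in *. lra.
  - refine (is_lim_seq_le_le_loc _ _ _ _ _ (Hm _) (Hp _)). exists J. intros j Hj.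
    pose proof (Rle_trans _ _ _ (im_le_Cmod _) (Hu j Hj)) as H.
    apply Rabs_le_between in H. simpl in H. unfold Im in *. lra.
Qed.

(** The increments are dominated by those of a convergent real sequence; telescoping carries the
    Cauchy property over from [t] to [u]. *)
Lemma is_lim_C_of_increments (u : nat -> C) (t : nat -> R) (B : R) :
  0 < B -> is_lim_seq t 0 ->
  (forall j, Cmod (u (S j) - u j) <= B * (t j - t (S j))) ->
  exists l, is_lim_C u l.
Proof.
  intros HB Ht Hu.
  assert (Hd : forall k j, Cmod (u (k + j)%nat - u j) <= B * (t j - t (k + j)%nat)).
  { induction k as [|k IH]; intro j.
    - simpl. replace (u j - u j)%C with (RtoC 0) by ring. rewrite Cmod_0. lra.
    - simpl. replace (u (S (k + j)) - u j)%C with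
        ((u (S (k + j)) - u (k + j)%nat) + (u (k + j)%nat - u j))%C by ring.
      eapply Rle_trans; [apply Cmod_triangle|].
      specialize (IH j). specialize (Hu (k + j)%nat). lra. }
  (* [p] stands for [Re] or [Im], so that completeness of the reals is invoked once for both. *)
  assert (HC : forall p : C -> R, (forall z, Rabs (p z) <= Cmod z) ->
     (forall z w, p (z - w)%C = p z - p w) -> ex_finite_lim_seq (fun j => p (u j))).
  { intros p Hp Hpm. apply ex_lim_seq_cauchy_corr. intro eps.
    assert (Hcau : ex_lim_seq_cauchy t) by (apply ex_lim_seq_cauchy_corr; now exists 0).
    assert (He : 0 < eps / B) by (apply Rdiv_lt_0_compat; [apply cond_pos | easy]).
    destruct (Hcau (mkposreal _ He)) as [N HN]. simpl in HN. exists N.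
    assert (Hle : forall a b, (N <= a)%nat -> (a <= b)%nat -> Rabs (p (u b) - p (u a)) < eps).
    { intros a b Ha Hab. rewrite <- Hpm.
      eapply Rle_lt_trans; [apply Hp|].
      replace b with ((b - a) + a)%nat by lia.
      eapply Rle_lt_trans; [apply Hd|].
      replace (b - a + a)%nat with b by lia.
      apply (Rle_lt_trans _ (B * Rabs (t a - t b))).
      - apply Rmult_le_compat_l; [lra | apply Rle_abs].
      - replace (pos eps) with (B * (eps / B)) by (field; lra).
        apply Rmult_lt_compat_l; [easy|]. apply HN; lia. }
    intros a b Ha Hb. destruct (Nat.le_ge_cases a b) as [H|H].
    - rewrite Rabs_minus_sym. now apply Hle.
    - now apply Hle. }
  destruct (HC Re re_le_Cmod) as [a Ha]; [easy|].
  destruct (HC Im im_le_Cmod) as [b Hb]; [easy|].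
  now exists (a, b).
Qed.

(** A discrete Gronwall argument: each step multiplies the modulus by at most [1 + (t j - t (S j))],
    hence by at most the exponential of that difference. The product telescopes, so the sequence is
    bounded and its absolute increments are controlled too. *)
Lemma is_lim_C_of_ratios (u : nat -> C) (t : nat -> R) (J : nat) :
  is_lim_seq t 0 -> (forall j, t (S j) <= t j) ->
  (forall j, (J <= j)%nat -> Cmod (u (S j) - u j) <= Cmod (u j) * (t j - t (S j))) ->
  exists l, is_lim_C u l.
Proof.
  intros Ht Hdec Hu.
  set (v := fun j => u (j + J)%nat). set (s := fun j => t (j + J)%nat).
  assert (Hs : is_lim_seq s 0) by now apply (is_lim_seq_incr_n t J).
  assert (Hs' : forall j, s (S j) <= s j) by (intro j; apply Hdec).
  assert (Hv : forall j, Cmod (v (S j) - v j) <= Cmod (v j) * (s j - s (S j))).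
  { intro j. apply (Hu (j + J)%nat). lia. }
  assert (Hb : forall j, Cmod (v j) <= Cmod (v O) * exp (s O - s j)).
  { induction j as [|j IH].
    - rewrite Rminus_diag, exp_0. lra.
    - replace (v (S j)) with (v j + (v (S j) - v j))%C by ring.
      eapply Rle_trans; [apply Cmod_triangle|].
      apply (Rle_trans _ (Cmod (v j) * exp (s j - s (S j)))).
      + specialize (Hv j). pose proof (exp_ineq1_le (s j - s (S j))).
        pose proof (Cmod_ge_0 (v j)). nra.
      + replace (s O - s (S j)) with ((s O - s j) + (s j - s (S j))) by ring.
        rewrite exp_plus, <- Rmult_assoc. apply Rmult_le_compat_r; [left; apply exp_pos | easy]. }
  (* The added 1 keeps [B] positive even when [v O] is zero. *)
  set (B := Cmod (v O) * exp (s O) + 1).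
  assert (HB : forall j, Cmod (v j) <= B).
  { intro j. eapply Rle_trans; [apply Hb|]. unfold B.
    assert (H0 : 0 <= s j) by now apply (is_lim_seq_decr_compare s 0).
    pose proof (Cmod_ge_0 (v O)).
    assert (exp (s O - s j) <= exp (s O)); [|nra].
    destruct (Req_dec (s j) 0) as [E|E].
    - rewrite E, Rminus_0_r. lra.
    - left. apply exp_increasing. lra. }
  assert (HB0 : 0 < B).
  { unfold B. pose proof (Cmod_ge_0 (v O)). pose proof (exp_pos (s O)). nra. }
  destruct (is_lim_C_of_increments v s B HB0 Hs) as [l Hl].
  - intro j. eapply Rle_trans; [apply Hv|].
    apply Rmult_le_compat_r; [specialize (Hs' j); lra | easy].
  - exists l. now apply (is_lim_C_incr_n u J).
Qed.

(** * Euler's limit for the gamma function *)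

Lemma Cmod_1_plus_ge (w : C) : Cmod w <= 1 / 2 -> 1 / 2 <= Cmod (1 + w).
Proof.
  intro Hw. pose proof (Cmod_triangle (1 + w) (- w)) as H.
  replace (1 + w + - w)%C with (RtoC 1) in H by ring.
  rewrite Cmod_1, Cmod_opp in H. lra.
Qed.

Lemma rising_neq_0 (z : C) (j : nat) :
  (forall k : nat, z <> RtoC (- INR k)) -> rising z j <> RtoC 0.
Proof.
  intro Hz.
  assert (Hk : forall k : nat, (z + RtoC (INR k))%C <> RtoC 0).
  { intros k E. apply (Hz k). rewrite RtoC_opp.
    replace z with ((z + RtoC (INR k)) - RtoC (INR k))%C by ring. rewrite E. ring. }
  induction j as [|j IH]; simpl rising.
  - specialize (Hk O). simpl in Hk. now rewrite Cplus_0_r in Hk.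
  - apply Cmult_neq_0; [exact IH | exact (Hk (S j))].
Qed.

Lemma cexp_neq_0 (z : C) : cexp z <> RtoC 0.
Proof.
  intro E. assert (H : (cexp z * cexp (- z))%C = RtoC 1).
  { rewrite <- cexp_plus. replace (z + - z)%C with (RtoC 0) by ring.
    unfold cexp. simpl. rewrite exp_0, cos_0, sin_0.
    apply injective_projections; simpl; ring. }
  rewrite E, Cmult_0_l in H. injection H. lra.
Qed.

(** The sequence under the limit in [CGamma], convertible with it so that [change] passes between
    the two. *)
Definition euler_seq (z : C) (j : nat) : C :=
  (RtoC (INR (fact j)) * cpower (INR j) z / rising z j)%C.

Lemma euler_seq_neq_0 (z : C) (j : nat) :
  (forall k : nat, z <> RtoC (- INR k)) -> euler_seq z j <> RtoC 0.
Proof.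
  intro Hz. unfold euler_seq, Cdiv.
  apply Cmult_neq_0; [apply Cmult_neq_0|].
  - apply RtoC_neq_0, INR_fact_neq_0.
  - apply cexp_neq_0.
  - intro E. apply (C1_nz). rewrite <- (Cinv_r (rising z j)), E, Cmult_0_r; [easy|].
    now apply rising_neq_0.
Qed.

Lemma cpower_succ (z : C) (j : nat) : (1 <= j)%nat ->
  cpower (INR (S j)) z = (cpower (INR j) z * cexp (z * RtoC (ln ((INR j + 1) / INR j))))%C.
Proof.
  intro Hj. assert (0 < INR j) by now apply lt_0_INR.
  unfold cpower. rewrite <- cexp_plus. f_equal.
  rewrite <- Cmult_plus_distr_l, <- RtoC_plus. do 2 f_equal.
  rewrite S_INR, <- ln_mult by (try apply Rdiv_lt_0_compat; lra).
  f_equal. field. lra.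
Qed.

Lemma euler_seq_succ (z : C) (j : nat) :
  (forall k : nat, z <> RtoC (- INR k)) -> (1 <= j)%nat ->
  (euler_seq z (S j) * (1 + z / RtoC (INR (S j))) =
   euler_seq z j * cexp (z * RtoC (ln ((INR j + 1) / INR j))))%C.
Proof.
  intros Hz Hj. unfold euler_seq.
  rewrite cpower_succ by easy. rewrite fact_simpl, mult_INR, RtoC_mult.
  pose proof (rising_neq_0 z (S j) Hz) as H. simpl rising in *.
  assert (HS : RtoC (INR (S j)) <> RtoC 0) by (apply RtoC_neq_0; now apply not_0_INR).
  change (match j with O => 1 | S _ => INR j + 1 end) with (INR (S j)) in *.
  assert (rising z j <> RtoC 0) by (intro E; apply H; rewrite E; ring).
  assert ((z + RtoC (INR (S j)))%C <> RtoC 0) by (intro E; apply H; rewrite E; ring).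
  field. auto.
Qed.

(** By [euler_seq_succ], consecutive Euler terms have ratio [E / N] with [N = 1 + z / (j + 1)]. The
    first-order parts of [E] and [N] nearly agree, so [D = E - N] is [O(1 / j^2)], dominated by a
    telescoping difference. Both [E] and [N] are bounded below because the inverse sequence is
    treated too; dividing by either costs the factor 2. *)
Lemma euler_ratio_bounds (z : C) (j : nat) (E D : C) :
  (1 <= j)%nat -> 20 * Cmod z <= INR j ->
  E = cexp (z * RtoC (ln ((INR j + 1) / INR j)))%C ->
  D = (E - (1 + z / RtoC (INR (S j))))%C ->
  let K := 20 * Cmod z ^ 2 + Cmod z in
  1 / 2 <= Cmod E /\ 1 / 2 <= Cmod (1 + z / RtoC (INR (S j))) /\
  2 * Cmod D <= 6 * K / INR (S j) - 6 * K / INR (S (S j)).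
Proof.
  intros Hj Hz HE HD K.
  assert (Hj1 : 1 <= INR j) by now apply (le_INR 1).
  rewrite (S_INR (S j)). rewrite S_INR in *. set (x := INR j) in *.
  set (L := ln ((x + 1) / x)) in *. set (r := Cmod z) in *.
  assert (Hr : 0 <= r) by apply Cmod_ge_0.
  destruct (ln_succ_div_bounds x ltac:(lra)) as [HL1 HL2]. fold L in HL1, HL2.
  assert (HLi : 0 < / (x + 1)) by (apply Rinv_0_lt_compat; lra).
  assert (Hx : r * / x <= 1 / 20).
  { apply (Rmult_le_reg_r x); [lra|]. rewrite Rmult_assoc, Rinv_l by lra. lra. }
  assert (HzL : Cmod (z * RtoC L) = r * L).
  { rewrite Cmod_mult, Cmod_R, Rabs_pos_eq by lra. easy. }
  assert (HzN : Cmod (z / RtoC (x + 1)) = r * / (x + 1)).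
  { rewrite Cmod_div by (apply RtoC_neq_0; lra). rewrite Cmod_R, Rabs_pos_eq by lra. easy. }
  assert (HrL : r * L <= 1 / 20) by nra.
  assert (HrN : r * / (x + 1) <= 1 / 20) by nra.
  assert (HrL0 : 0 <= r * L) by nra.
  pose proof (Cmod_cexp_minus_1_minus_id_le (z * RtoC L)) as HC.
  rewrite HzL in HC. specialize (HC ltac:(lra)). rewrite <- HE in HC.
  split; [|split].
  - replace E with (1 + ((E - 1 - z * RtoC L) + z * RtoC L))%C by ring.
    apply Cmod_1_plus_ge. eapply Rle_trans; [apply Cmod_triangle|].
    rewrite HzL. nra.
  - apply Cmod_1_plus_ge. lra.
  (* The two terms of [K] come from here: [L ^ 2 <= / x ^ 2 <= 2 * d] turns the first into
     [20 * r ^ 2 * d], and [L - / (x + 1) <= d] turns the second into [r * d]. *)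
  - assert (HDK : Cmod D <= 10 * (r * L) ^ 2 + r * (L - / (x + 1))).
    { replace D with ((E - 1 - z * RtoC L) + z * RtoC (L - / (x + 1)))%C.
      - eapply Rle_trans; [apply Cmod_triangle|].
        rewrite Cmod_mult, Cmod_R, (Rabs_pos_eq (L - _)) by lra. fold r. lra.
      - rewrite HD, RtoC_minus, RtoC_inv by lra. field. apply RtoC_neq_0; lra. }
    set (d := / (x * (x + 1))).
    assert (Hd : / x - / (x + 1) = d) by (unfold d; field; lra).
    assert (Hd2 : / x * / x <= 2 * d).
    { unfold d. rewrite Rinv_mult. assert (/ x <= 2 * / (x + 1)); [|assert (0 < / x) by (apply Rinv_0_lt_compat; lra); nra].
      apply (Rmult_le_reg_r (x * (x + 1))); [nra|]. field_simplify; lra. }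
    assert (HDK' : Cmod D <= K * d).
    { unfold K. assert (L * L <= 2 * d) by nra.
      assert (r ^ 2 * (L * L) <= r ^ 2 * (2 * d)) by (apply Rmult_le_compat_l; nra).
      assert (r * (L - / (x + 1)) <= r * d) by (apply Rmult_le_compat_l; lra).
      nra. }
    assert (HK : 0 <= K) by (unfold K; nra).
    (* The factor 3 absorbs the index shift: [x + 2 <= 3 * x] since [x >= 1]. *)
    replace (6 * K / (x + 1) - 6 * K / (x + 1 + 1)) with
      (2 * (K * (3 * / ((x + 1) * (x + 1 + 1))))) by (field; lra).
    apply Rmult_le_compat_l; [lra|]. eapply Rle_trans; [exact HDK'|].
    apply Rmult_le_compat_l; [easy|]. unfold d.
    apply (Rmult_le_reg_r (x * (x + 1) * (x + 1 + 1))); [nra|]. field_simplify; nra.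
Qed.

Lemma is_lim_seq_div_S (K : R) : is_lim_seq (fun j => K / INR (S j)) 0.
Proof.
  replace (Finite 0) with (Rbar_mult K 0) by (simpl; f_equal; ring).
  apply (is_lim_seq_scal_l (fun j => / INR (S j))).
  apply (is_lim_seq_incr_1 (fun j => / INR j)).
  replace (Finite 0) with (Rbar_inv p_infty) by easy.
  apply is_lim_seq_inv; [apply is_lim_seq_INR | easy].
Qed.

Lemma euler_seq_limit (z : C) :
  (forall k : nat, z <> RtoC (- INR k)) ->
  exists l, l <> RtoC 0 /\ is_lim_C (euler_seq z) l.
Proof.
  intro Hz. set (K := 20 * Cmod z ^ 2 + Cmod z).
  assert (HK : 0 <= K) by (unfold K; pose proof (Cmod_ge_0 z); nra).
  set (t := fun j => 6 * K / INR (S j)).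
  assert (Ht : is_lim_seq t 0) by apply is_lim_seq_div_S.
  assert (Hdec : forall j, t (S j) <= t j).
  { intro j. unfold t, Rdiv. apply Rmult_le_compat_l; [lra|].
    apply Rinv_le_contravar; [apply lt_0_INR; lia | apply le_INR; lia]. }
  (* The summand 1 also forces [j >= 1], where [ln ((j + 1) / j)] makes sense. *)
  destruct (INR_unbounded (20 * Cmod z + 1)) as [J HJ].
  assert (HJ' : forall j, (J <= j)%nat -> (1 <= j)%nat /\ 20 * Cmod z <= INR j).
  { intros j Hj. apply le_INR in Hj. pose proof (Cmod_ge_0 z). split; [|lra].
    apply INR_le. simpl. lra. }
  assert (Hu : exists l, is_lim_C (euler_seq z) l).
  { apply (is_lim_C_of_ratios _ t J Ht Hdec). intros j Hj.
    destruct (HJ' j Hj) as [Hj1 Hjz]. pose proof (euler_seq_succ z j Hz Hj1) as Hs.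
    destruct (euler_ratio_bounds z j _ _ Hj1 Hjz eq_refl eq_refl) as (HE & HN & HD).
    set (E := cexp _) in *. set (N := (1 + z / RtoC (INR (S j)))%C) in *.
    fold K in HD. change (2 * Cmod (E - N) <= t j - t (S j)) in HD.
    assert (N <> RtoC 0) by (intro E0; rewrite E0, Cmod_0 in HN; lra).
    replace (euler_seq z (S j) - euler_seq z j)%C with (euler_seq z j * ((E - N) / N))%C.
    2:{ replace (euler_seq z (S j)) with (euler_seq z j * E / N)%C by (rewrite <- Hs; now field).
        now field. }
    rewrite Cmod_mult. apply Rmult_le_compat_l; [apply Cmod_ge_0|].
    rewrite Cmod_div by easy. eapply Rle_trans; [|exact HD].
    apply (Rmult_le_reg_r (Cmod N)); [lra|]. unfold Rdiv. rewrite Rmult_assoc, Rinv_l by lra.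
    pose proof (Cmod_ge_0 (E - N)). nra. }
  assert (Hw : exists l, is_lim_C (fun j => / euler_seq z j)%C l).
  { apply (is_lim_C_of_ratios _ t J Ht Hdec). intros j Hj.
    destruct (HJ' j Hj) as [Hj1 Hjz]. pose proof (euler_seq_succ z j Hz Hj1) as Hs.
    destruct (euler_ratio_bounds z j _ _ Hj1 Hjz eq_refl eq_refl) as (HE & HN & HD).
    pose proof (euler_seq_neq_0 z j Hz). pose proof (euler_seq_neq_0 z (S j) Hz).
    set (E := cexp _) in *. set (N := (1 + z / RtoC (INR (S j)))%C) in *.
    fold K in HD. change (2 * Cmod (E - N) <= t j - t (S j)) in HD.
    assert (HN0 : N <> RtoC 0) by (intro E0; rewrite E0, Cmod_0 in HN; lra).
    assert (HE0 : E <> RtoC 0) by apply cexp_neq_0.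
    replace (/ euler_seq z (S j) - / euler_seq z j)%C
      with (/ euler_seq z j * (- (E - N) / E))%C.
    2:{ replace (euler_seq z (S j)) with (euler_seq z j * E / N)%C by (rewrite <- Hs; now field).
        field. auto. }
    rewrite Cmod_mult. apply Rmult_le_compat_l; [apply Cmod_ge_0|].
    rewrite Cmod_div, Cmod_opp by easy. eapply Rle_trans; [|exact HD].
    apply (Rmult_le_reg_r (Cmod E)); [lra|]. unfold Rdiv. rewrite Rmult_assoc, Rinv_l by lra.
    pose proof (Cmod_ge_0 (E - N)). nra. }
  destruct Hu as [l Hl], Hw as [k Hk]. exists l. split; [|easy].
  (* The product of the sequence and its inverse is constantly 1, so a zero limit would give 0 =
     1. *)
  intro E0. pose proof (is_lim_C_mult _ _ _ _ Hl Hk) as Hlk.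
  apply (is_lim_C_ext_loc _ (fun _ => RtoC 1) _ 0) in Hlk.
  - rewrite E0, Cmult_0_l in Hlk.
    pose proof (C_lim_seq_unique _ _ Hlk) as H0.
    rewrite (C_lim_seq_unique _ _ (is_lim_C_const 1)) in H0. injection H0. lra.
  - intros j _. apply Cinv_r. now apply euler_seq_neq_0.
Qed.

Lemma CGamma_neq_0 (z : C) :
  (forall k : nat, z <> RtoC (- INR k)) -> CGamma z <> RtoC 0.
Proof.
  intro Hz. destruct (euler_seq_limit z Hz) as (l & Hl0 & Hl).
  change (CGamma z) with (C_lim_seq (euler_seq z)). now rewrite (C_lim_seq_unique _ _ Hl).
Qed.

(** * The functional equation of the gamma function *)

Lemma rising_succ (z : C) (j : nat) :
  (z * rising (z + 1) j = rising z j * (z + RtoC (INR (S j))))%C.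
Proof.
  induction j as [|j IH].
  - simpl. ring.
  - change (rising (z + 1) (S j)) with (rising (z + 1) j * (z + 1 + RtoC (INR (S j))))%C.
    rewrite Cmult_assoc, IH. rewrite (S_INR (S j)), RtoC_plus.
    change (rising z (S j)) with (rising z j * (z + RtoC (INR (S j))))%C. ring.
Qed.

Lemma CGamma_succ (z : C) :
  (forall k : nat, z <> RtoC (- INR k)) -> CGamma (z + 1) = (z * CGamma z)%C.
Proof.
  intro Hz. destruct (euler_seq_limit z Hz) as (l & _ & Hl).
  change (CGamma z) with (C_lim_seq (euler_seq z)). rewrite (C_lim_seq_unique _ _ Hl).
  apply (C_lim_seq_unique (euler_seq (z + 1))).
  assert (Hz0 : z <> RtoC 0).
  { specialize (Hz O). simpl in Hz. now rewrite Ropp_0 in Hz. }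
  assert (Hz1 : forall k : nat, (z + 1)%C <> RtoC (- INR k)).
  { intros k E. apply (Hz (S k)). rewrite S_INR.
    replace z with (z + 1 - 1)%C by ring. rewrite E, <- RtoC_minus. f_equal. ring. }
  (* This is the factor [j / (z + j + 1)] between [euler_seq (z + 1) j] and [z * euler_seq z j].
     Once [j] exceeds [2 * Cmod z], the denominator has modulus at least [(j + 1) / 2]. *)
  assert (Hq : is_lim_C (fun j => 1 + - ((z + 1) / (z + RtoC (INR (S j)))))%C (RtoC 1)).
  { destruct (INR_unbounded (2 * Cmod z)) as [J HJ].
    apply (is_lim_C_of_Cmod_le _ _ _ J (is_lim_seq_div_S (2 * Cmod (z + 1)))).
    intros j Hj. apply le_INR in Hj.
    assert (HN : Cmod z <= INR (S j) / 2) by (rewrite S_INR; lra).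
    assert (HS : 0 < INR (S j)) by (apply lt_0_INR; lia).
    set (N := INR (S j)) in *.
    assert (HzN : N / 2 <= Cmod (z + RtoC N)).
    { pose proof (Cmod_triangle (z + RtoC N) (- z)) as T.
      replace (z + RtoC N + - z)%C with (RtoC N) in T by ring.
      rewrite Cmod_R, Cmod_opp, Rabs_pos_eq in T; lra. }
    replace (1 + - ((z + 1) / (z + RtoC N)) - 1)%C with (- ((z + 1) / (z + RtoC N)))%C by ring.
    rewrite Cmod_opp, Cmod_div by (intro E; rewrite E, Cmod_0 in HzN; lra).
    apply (Rmult_le_reg_r (Cmod (z + RtoC N) * N)); [nra|].
    pose proof (Cmod_ge_0 (z + 1)). field_simplify; [nra|lra|lra]. }
  pose proof (is_lim_C_mult _ _ _ _ (is_lim_C_mult _ _ _ _ (is_lim_C_const z) Hl) Hq) as H.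
  rewrite Cmult_1_r in H.
  refine (is_lim_C_ext_loc _ _ _ 1 _ H). intros j Hj.
  unfold euler_seq. rewrite cpower_plus, cpower_1 by now apply lt_0_INR.
  pose proof (rising_succ z j) as Hr.
  pose proof (rising_neq_0 z j Hz). pose proof (rising_neq_0 (z + 1) j Hz1).
  assert (Hzj : (z + RtoC (INR (S j)))%C <> RtoC 0).
  { intro E. rewrite E, Cmult_0_r in Hr. now apply (Cmult_neq_0 _ _ Hz0 H1). }
  replace (rising (z + 1) j) with (rising z j * (z + RtoC (INR (S j))) / z)%C
    by (rewrite <- Hr; now field).
  rewrite S_INR, RtoC_plus in *. field. auto.
Qed.

(** * The iterated antiderivative *)

Lemma zeta_star_ones_0 (m : C) (q : nat) : zeta_star_ones m 0 (S q) = RtoC 0.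
Proof. simpl. now rewrite sum_n_m_zero by lia. Qed.

Lemma zeta_star_ones_succ (m : C) (n q : nat) :
  zeta_star_ones m (S n) (S q) =
  (zeta_star_ones m n (S q) + / (m + RtoC (INR (S n))) * zeta_star_ones m (S n) q)%C.
Proof.
  change (zeta_star_ones m (S n) (S q)) with
    (sum_n_m (fun r => (/ (m + RtoC (INR r)) * zeta_star_ones m r q)%C) 1 (S n)).
  now rewrite sum_n_Sm by lia.
Qed.

(** The bracket of the closed form as a polynomial in [L], which stands for [ln x]. *)
Definition star_sum (m : C) (n p : nat) (L : C) : C :=
  sum_n (fun k => RtoC (-1) ^ (p - k) * (L ^ k / RtoC (INR (fact k)))
                  * zeta_star_ones m n (p - k))%C p.

Definition star_sum_deriv (m : C) (n p : nat) (L : C) : C :=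
  match p with O => RtoC 0 | S q => star_sum m n q L end.

(** Sign and zeta value depend only on [p - k], so lowering [k] by differentiation amounts to
    lowering [p]; the term [k = 0] is constant. *)
Lemma is_derive_star_sum (m : C) (n p : nat) (L : R) :
  is_derive_RC (fun t => star_sum m n p (RtoC t)) L (star_sum_deriv m n p (RtoC L)).
Proof.
  destruct p as [|q].
  - apply (is_derive_ext (V := C_R_NormedModule) (fun _ => star_sum m n 0 (RtoC 0))).
    { intro t. unfold star_sum. now rewrite !sum_O. }
    apply is_derive_RC_const.
  - apply (is_derive_ext (V := C_R_NormedModule) (fun t =>
      RtoC (-1) ^ S q * zeta_star_ones m n (S q) +
      sum_n (fun k => RtoC (-1) ^ (q - k) * zeta_star_ones m n (q - k) *
         (RtoC t ^ S k / RtoC (INR (fact (S k))))) q)%C).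
    { intro t. unfold star_sum. unfold sum_n at 2. rewrite sum_Sn_m, <- sum_n_m_S by lia.
      change plus with Cplus. fold (sum_n (G := C_AbelianMonoid)). f_equal.
      - rewrite Nat.sub_0_r. simpl. field.
      - apply sum_n_m_ext. intro k. change (S q - S k)%nat with (q - k)%nat.
        eq_in_C. ring. }
    eapply is_derive_RC_eq.
    + apply is_derive_RC_plus; [apply is_derive_RC_const|].
      apply (is_derive_RC_sum_n (fun k t => RtoC (-1) ^ (q - k) * zeta_star_ones m n (q - k) *
         (RtoC t ^ S k / RtoC (INR (fact (S k)))))%C
        (fun k t => RtoC (-1) ^ (q - k) * zeta_star_ones m n (q - k) *
         (RtoC t ^ k / RtoC (INR (fact k))))%C).
      intros k _. apply is_derive_RC_scal, is_derive_monomial.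
    + rewrite Cplus_0_l. apply sum_n_ext. intro k.
      eq_in_C. ring.
Qed.

(** The left side is what differentiating [x^N * star_sum (ln x)] produces, with [N = m + n + 1] and
    [x^(N-1)] taken out. By the zeta recurrence, passing from [n] to [n + 1] adds terms of depth one
    less divided by [N]; their signs are opposite to those in the derivative, so they cancel. *)
Lemma star_sum_succ (m : C) (n p : nat) (L : C) :
  (m + RtoC (INR (S n)))%C <> RtoC 0 ->
  ((m + RtoC (INR (S n))) * star_sum m (S n) p L + star_sum_deriv m (S n) p L =
   (m + RtoC (INR (S n))) * star_sum m n p L)%C.
Proof.
  intro HN. set (N := (m + RtoC (INR (S n)))%C) in *.
  destruct p as [|q].
  - simpl. unfold star_sum. rewrite !sum_O. simpl. ring.
  - unfold star_sum_deriv, star_sum. rewrite !sum_Sn. change plus with Cplus.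
    rewrite !Cmult_plus_distr_l, Nat.sub_diag.
    change (zeta_star_ones m (S n) 0) with (zeta_star_ones m n 0).
    rewrite <- !(sum_n_mult_l (K := C_Ring)).
    (* [b] is the top term [k = p], where the zeta value is 1 for both [n] and [n + 1]; the rest is
       compared term by term. *)
    match goal with |- (?a + ?b + ?c = ?d + ?b)%C => enough (E : (a + c)%C = d) end.
    { rewrite <- E. ring. }
    etransitivity; [symmetry; apply (sum_n_plus (G := C_AbelianMonoid))|].
    apply (sum_n_ext_loc (G := C_AbelianMonoid)). intros k Hk.
    change plus with Cplus. change mult with Cmult.
    eq_in_C.
    replace (S q - k)%nat with (S (q - k)) by lia.
    rewrite zeta_star_ones_succ, Cpow_S. fold N.
    generalize (RtoC (-1) ^ (q - k))%C. intro s.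
    replace (RtoC (-1)) with (- (1))%C by now rewrite <- RtoC_opp.
    unfold Cdiv. field_simplify_eq; [ring |].
    split; [apply RtoC_neq_0, INR_fact_neq_0 | exact HN].
Qed.

(** * The closed form and its derivative *)

Definition antideriv (m : C) (p n : nat) (x : R) : C :=
  (RtoC (INR (fact p)) * CGamma (m + 1)
   * (cpower x (RtoC (INR n) + m) / CGamma (RtoC (INR n) + m + 1))
   * star_sum m n p (RtoC (ln x)))%C.

Lemma shift_not_nonpos (m : C) (n k : nat) :
  (forall k : nat, (1 <= k)%nat -> m <> RtoC (- INR k)) ->
  (RtoC (INR n) + m + 1)%C <> RtoC (- INR k).
Proof.
  intros Hm E. apply (Hm (k + n + 1)%nat); [lia|].
  replace m with (RtoC (INR n) + m + 1 - RtoC (INR n) - 1)%C by ring.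
  rewrite E, !plus_INR, <- !RtoC_minus. f_equal. simpl. ring.
Qed.

(** For [n = 0] every zeta sum of positive depth is empty, so only [k = p] survives; the two gamma
    values coincide and cancel, being nonzero. *)
Lemma antideriv_0 (m : C) (p : nat) (x : R) :
  (forall k : nat, (1 <= k)%nat -> m <> RtoC (- INR k)) ->
  0 < x -> antideriv m p 0 x = (cpower x m * RtoC (ln x) ^ p)%C.
Proof.
  intros Hm Hx. unfold antideriv.
  pose proof (CGamma_neq_0 _ (fun k => shift_not_nonpos m 0 k Hm)) as HG.
  simpl INR in *. rewrite Cplus_0_l in *.
  replace (star_sum m 0 p (RtoC (ln x))) with (RtoC (ln x) ^ p / RtoC (INR (fact p)))%C.
  - field. split; [|easy]. apply RtoC_neq_0, INR_fact_neq_0.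
  - unfold star_sum. destruct p as [|q].
    + rewrite sum_O. simpl. field.
    + rewrite sum_Sn, Nat.sub_diag.
      rewrite (sum_n_ext_loc _ (fun _ => zero)).
      * unfold sum_n. rewrite sum_n_m_const_zero, plus_zero_l. simpl. ring.
      * intros k Hk. replace (S q - k)%nat with (S (q - k)) by lia.
        rewrite zeta_star_ones_0. apply Cmult_0_r.
Qed.

Lemma is_derive_antideriv (m : C) (p n : nat) (x : R) :
  (forall k : nat, (1 <= k)%nat -> m <> RtoC (- INR k)) ->
  0 < x -> is_derive_RC (antideriv m p (S n)) x (antideriv m p n x).
Proof.
  intros Hm Hx. unfold antideriv.
  pose proof (fun k => shift_not_nonpos m n k Hm) as Hn.
  pose proof (CGamma_neq_0 _ Hn) as HG. pose proof (CGamma_succ _ Hn) as HS.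
  assert (HN : (m + RtoC (INR (S n)))%C <> RtoC 0).
  { specialize (Hn O). simpl (INR 0) in Hn. rewrite Ropp_0 in Hn.
    rewrite S_INR, RtoC_plus. intro E. apply Hn. rewrite <- E. ring. }
  assert (Hx0 : RtoC x <> RtoC 0) by (apply RtoC_neq_0; lra).
  pose proof (star_sum_succ m n p (RtoC (ln x)) HN) as Hs.
  replace (RtoC (INR (S n)) + m + 1)%C with (RtoC (INR n) + m + 1 + 1)%C
    by (rewrite S_INR, RtoC_plus; ring).
  rewrite HS. replace (RtoC (INR n) + m + 1)%C with (m + RtoC (INR (S n)))%C in *
    by (rewrite S_INR, RtoC_plus; ring).
  set (N := (m + RtoC (INR (S n)))%C) in *.
  replace (RtoC (INR (S n)) + m)%C with N by (unfold N; ring).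
  assert (HP : cpower x N = (cpower x (RtoC (INR n) + m) * RtoC x)%C).
  { rewrite <- (cpower_1 x Hx), <- cpower_plus. f_equal. unfold N.
    rewrite S_INR, RtoC_plus. ring. }
  assert (Hln : is_derive_RC (fun t => star_sum m (S n) p (RtoC (ln t))) x
     (star_sum_deriv m (S n) p (RtoC (ln x)) / RtoC x)%C).
  { eapply is_derive_RC_eq.
    - apply (is_derive_comp (V := C_R_NormedModule)
        (fun t => star_sum m (S n) p (RtoC t)) ln x).
      + apply is_derive_star_sum.
      + now apply is_derive_ln.
    - destruct (star_sum_deriv m (S n) p (RtoC (ln x))) as [a b].
      change (((/ x * a, / x * b) : C) = ((a, b) / RtoC x)%C).
      unfold Cdiv. rewrite <- RtoC_inv by lra.
      apply injective_projections; simpl; ring. }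
  apply (is_derive_ext (V := C_R_NormedModule) (fun t =>
     (RtoC (INR (fact p)) * CGamma (m + 1) / (N * CGamma N)) *
      (cpower t N * star_sum m (S n) p (RtoC (ln t))))%C).
  { intro t. eq_in_C.
    unfold Cdiv. ring. }
  eapply is_derive_RC_eq.
  - apply is_derive_RC_scal, is_derive_RC_mult; [now apply is_derive_cpower | exact Hln].
  - cbv beta. rewrite HP.
    (* Pulling out [x^(n+m)] exposes the left side of [star_sum_succ]; the [N] it leaves cancels the
       one from [CGamma (N + 1) = N * CGamma N]. *)
    transitivity (RtoC (INR (fact p)) * CGamma (m + 1) / (N * CGamma N) *
      (cpower x (RtoC (INR n) + m) *
       (N * star_sum m (S n) p (RtoC (ln x)) + star_sum_deriv m (S n) p (RtoC (ln x)))))%C.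
    + field. auto.
    + rewrite Hs. field. auto.
Qed.

Lemma is_nth_derive_antideriv (m : C) (p n : nat) :
  (forall k : nat, (1 <= k)%nat -> m <> RtoC (- INR k)) ->
  is_nth_derive_pos n (antideriv m p n) (fun x => cpower x m * RtoC (ln x) ^ p)%C.
Proof.
  intro Hm. induction n as [|n IH].
  - intros x Hx. now apply antideriv_0.
  - exists (antideriv m p n). split; [|exact IH].
    intros x Hx. now apply is_derive_antideriv.
Qed.

Theorem theorem3p1 :
  forall (m : C) (m' n : nat),
    (forall k : nat, (1 <= k)%nat -> m <> RtoC (- INR k)) ->
    (1 <= n)%nat ->
    forall F : R -> C,
      is_nth_derive_pos n F (fun x => (cpower x m * RtoC (ln x) ^ m')%C) <->
      exists c : nat -> C, forall x : R, 0 < x ->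
        F x =
        (RtoC (INR (fact m')) * CGamma (m + 1)
           * (cpower x (RtoC (INR n) + m) / CGamma (RtoC (INR n) + m + 1))
           * sum_n (fun k =>
               RtoC (-1) ^ (m' - k)
                 * (RtoC (ln x) ^ k / RtoC (INR (fact k)))
                 * zeta_star_ones m n (m' - k)) m'
         + sum_n (fun i => c i * (RtoC x ^ i / RtoC (INR (fact i)))) (n - 1))%C.
Proof.
  intros m m' n Hm Hn F.
  destruct n as [|n]; [lia|]. replace (S n - 1)%nat with n by lia.
  (* For a successor, [poly_lt] and [antideriv] unfold to the two summands of the statement. *)
  exact (is_nth_derive_pos_iff (S n) (antideriv m m' (S n)) _
    (is_nth_derive_antideriv m m' (S n) Hm) F).
Qed.
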